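(* Let $X\subset\mathbb{R}^n$ be a nonempty compact convex centrally symmetric set. For every integer $0\le k\le n$ and every $0<\epsilon<1$, $$d_k(X)\; d_{n-(1-\epsilon)k}(X^\circ)\ \le\ c_1\sqrt{\frac{k}{\epsilon}},\qquad c_1=\frac{2}{\sqrt2-1}\ (\le 5).$$
   Context: $\|\cdot\|$ is the Euclidean norm. A set $X$ is centrally symmetric if $x\in X$ implies $-x\in X$. For a bounded set $K\subset\mathbb{R}^n$ and integer $0\le j\le n$, the Kolmogorov $j$-width is $d_j(K)=\min_{P}\sup_{x\in K}\|x-Px\|$, the minimum over all orthogonal projections $P$ of $\mathbb{R}^n$ onto $j$-dimensional linear subspaces; equivalently, $d_j(K)=\min_Q\sup_{x\in K}\|Qx\|$ over orthogonal projections $Q$ onto $(n-j)$-dimensional subspaces. It is non-increasing in $j$, with $d_n(K)=0$. For a real (non-integer) index $t\in[0,n]$, $d_t(K)$ means $d_{\lfloor t\rfloor}(K)$. The polar dual is $X^\circ=\{y:\ x\cdot y\le 1\text{ for all }x\in X\}$; if $X$ lies in a lower-dimensional subspace, $X^\circ$ is understood as the polar taken within the smallest linear subspace containing $X$ (regarded as a subset of $\mathbb{R}^n$). *)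

(* Defs.v *)
From mathcomp Require Import all_boot all_order all_algebra.
From mathcomp Require Import all_classical all_reals all_analysis.

Set Implicit Arguments.
Unset Strict Implicit.
Unset Printing Implicit Defensive.

Import Order.TTheory GRing.Theory Num.Theory.
Import numFieldNormedType.Exports.

Local Open Scope classical_set_scope.
Local Open Scope ring_scope.

Definition dotp (R : realType) (n : nat) (x y : 'rV[R]_n) : R :=
  \sum_(i < n) x 0 i * y 0 i.

(* The library norm on matrices is the max norm, hence this definition; both
   norms induce the same topology, so the library's [compact] is the usual
   compactness. *)
Definition enorm (R : realType) (n : nat) (x : 'rV[R]_n) : R :=
  Num.sqrt (dotp x x).

Definition centrally_symmetric (R : realType) (n : nat) (X : set 'rV[R]_n) :
  Prop := forall x, X x -> X (- x).

(* Vectors are rows, so the projection with matrix [P] is [x |-> x *m P]; it is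
   orthogonal exactly when [P] is symmetric, and its range has dimension
   [\rank P]. *)
Definition orthogonal_projection (R : realType) (n j : nat) (P : 'M[R]_n) :
  Prop := [/\ P *m P = P, P^T = P & \rank P = j].

(* Only meaningful for [K] bounded and nonempty and for [(j <= n)%N]: real
   [sup] and [inf] are [0] on sets that are empty or unbounded in the relevant
   direction. The outer infimum is the minimum, since the projections of rank
   [j] form a compact set on which the inner supremum is continuous. *)
Definition kolmogorov_width (R : realType) (n : nat) (K : set 'rV[R]_n)
    (j : nat) : R :=
  inf [set sup [set enorm (x - x *m P) | x in K]
      | P in [set P : 'M[R]_n | orthogonal_projection j P]].

(* On nonnegative reals [Num.truncn] is the floor. *)
Definition kolmogorov_width_real (R : realType) (n : nat) (K : set 'rV[R]_n)
    (t : R) : R :=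
  kolmogorov_width K (Num.truncn t).

Definition linear_hull (R : realType) (n : nat) (X : set 'rV[R]_n) :
  set 'rV[R]_n :=
  smallest [set S | exists V : {vspace 'rV[R]_n}, S = [set x | x \in V]] X.

(* The polar is taken inside the linear hull of [X]; if [X] spans the whole
   space this is the usual polar dual. *)
Definition polar (R : realType) (n : nat) (X : set 'rV[R]_n) :
  set 'rV[R]_n :=
  [set y | linear_hull X y /\ forall x, X x -> dotp x y <= 1].

Definition c1 (R : realType) : R := 2 / (Num.sqrt 2 - 1).

(* Main.v *)
Require Import Defs.
From mathcomp Require Import all_boot all_order all_algebra perm.
From mathcomp Require Import all_classical all_reals all_analysis.
From mathcomp Require Import ring lra.

(** Write [a] for the [k]-width of [X] and let [m <= k] be [n] minus the
    index at which the width of the polar is taken. If [X] contains an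
    [m]-dimensional ellipsoid all of whose semi-axes are at least [s], then the
    projection onto the span of that ellipsoid sends the polar into a ball of
    radius [1 / s] ([kolmogorov_width_polar_le]), so the polar has
    [(n - m)]-width at most [1 / s]. It therefore suffices to find such an
    ellipsoid with [s] of order [a / sqrt m].

    An ellipsoid in [X] of (almost) maximal [m]-dimensional volume will do
    ([exists_fat_inscribed]). Suppose that one of its semi-axes has length [s],
    and remove it. The remaining ones span a space of dimension [m - 1 < k], so
    by definition of the width some [x] in [X] is at distance (almost) [a] from
    that space. By convexity and symmetry, [X] contains the ellipsoid that has
    the kept part shrunk by [sqrt (1 - l)] and [x] shrunk by [sqrt l] in place
    of the removed axis ([inscribed_col_mx]). Its squared volume is at
    least [l * (1 - l) ^ (m - 1) * a ^ 2 / s ^ 2] times the original one, and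
    maximality keeps this factor from exceeding [1]. With [l = 1 / (2 * m)],
    Bernoulli's inequality bounds [s ^ 2] from below by [a ^ 2 / (4 * m)].

    The suprema involved are only approached: a squared volume above half of the
    supremum and a distance just below [a] cost a constant factor, and the
    product of the two widths comes out at most [4 * sqrt m]
    ([kolmogorov_width_mul_polar_le]). This is enough because [c1] is at least
    [4] and [m <= k <= k / eps].

    An ellipsoid is represented by a matrix [M] of which it is the image of the
    unit ball, and squared volumes are Gram determinants. The volume comparison
    is then the formula base times height ([det_gram_col_mx]), applied after an
    orthogonal change of the parameter that turns any prescribed unit vector
    into the first one ([unit_row_completion]). *)

Set Implicit Arguments.
Unset Strict Implicit.
Unset Printing Implicit Defensive.

Import Order.TTheory GRing.Theory Num.Theory.
Import numFieldNormedType.Exports.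

Local Open Scope classical_set_scope.
Local Open Scope ring_scope.

(** * Euclidean inner product *)

Lemma dotpE (R : realType) n (x y : 'rV[R]_n) : dotp x y = (x *m y^T) 0 0.
Proof. by rewrite mxE; apply: eq_bigr => i _; rewrite mxE. Qed.

Lemma mulmx_dotp (R : realType) n (x y : 'rV[R]_n) :
  x *m y^T = (dotp x y)%:M.
Proof. by rewrite dotpE -mx11_scalar. Qed.

Lemma dotpC (R : realType) n (x y : 'rV[R]_n) : dotp x y = dotp y x.
Proof. by apply: eq_bigr => i _; rewrite mulrC. Qed.

Lemma dotpDl (R : realType) n (x y z : 'rV[R]_n) :
  dotp (x + y) z = dotp x z + dotp y z.
Proof. by rewrite !dotpE mulmxDl mxE. Qed.

Lemma dotpZl (R : realType) n a (x y : 'rV[R]_n) :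
  dotp (a *: x) y = a * dotp x y.
Proof. by rewrite !dotpE -scalemxAl mxE. Qed.

Lemma dotpNl (R : realType) n (x y : 'rV[R]_n) : dotp (- x) y = - dotp x y.
Proof. by rewrite -scaleN1r dotpZl mulN1r. Qed.

Lemma dotpDr (R : realType) n (x y z : 'rV[R]_n) :
  dotp z (x + y) = dotp z x + dotp z y.
Proof. by rewrite dotpC dotpDl !(dotpC z). Qed.

Lemma dotpZr (R : realType) n a (x y : 'rV[R]_n) :
  dotp y (a *: x) = a * dotp y x.
Proof. by rewrite dotpC dotpZl dotpC. Qed.

Lemma dotpNr (R : realType) n (x y : 'rV[R]_n) : dotp y (- x) = - dotp y x.
Proof. by rewrite dotpC dotpNl dotpC. Qed.

Lemma dotp_mulmxl (R : realType) m n (x : 'rV[R]_m) (A : 'M[R]_(m, n)) y :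
  dotp (x *m A) y = dotp x (y *m A^T).
Proof. by rewrite !dotpE trmx_mul trmxK mulmxA. Qed.

Lemma dotp_row_mx (R : realType) m n (a b : 'rV[R]_m) (c d : 'rV[R]_n) :
  dotp (row_mx a c) (row_mx b d) = dotp a b + dotp c d.
Proof. by rewrite !dotpE tr_row_mx mul_row_col mxE. Qed.

Lemma dotp_ge0 (R : realType) n (x : 'rV[R]_n) : 0 <= dotp x x.
Proof. by apply: sumr_ge0 => i _; rewrite -expr2 sqr_ge0. Qed.

Lemma dotp_eq0 (R : realType) n (x : 'rV[R]_n) : (dotp x x == 0) = (x == 0).
Proof.
apply/idP/eqP => [|->]; last by rewrite dotpE mul0mx mxE.
rewrite psumr_eq0 => [/allP x0|i _]; last by rewrite -expr2 sqr_ge0.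
apply/rowP => i; have /implyP/(_ isT) := x0 i (mem_index_enum i).
by rewrite -expr2 sqrf_eq0 mxE => /eqP.
Qed.

Lemma enorm_sqr (R : realType) n (x : 'rV[R]_n) : enorm x ^+ 2 = dotp x x.
Proof. exact/sqr_sqrtr/dotp_ge0. Qed.

Lemma enorm_ge0 (R : realType) n (x : 'rV[R]_n) : 0 <= enorm x.
Proof. exact: sqrtr_ge0. Qed.

Lemma enorm_normalize (R : realType) n (x : 'rV[R]_n) :
  exists2 u : 'rV[R]_n, dotp u u <= 1 & x = enorm x *: u.
Proof.
exists ((enorm x)^-1 *: x).
  rewrite dotpZl dotpZr mulrA -expr2 exprVn enorm_sqr.
  by have [->|d0] := eqVneq (dotp x x) 0; rewrite ?mulr0 ?ler01 ?mulVf.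
have [e0|e0] := eqVneq (enorm x) 0; last by rewrite scalerA divff ?scale1r.
by rewrite e0 scale0r; apply/eqP; rewrite -dotp_eq0 -enorm_sqr e0 expr0n.
Qed.

Lemma dotp_isometry (R : realType) m n (U : 'M[R]_(m, n)) (x y : 'rV[R]_m) :
  U *m U^T = 1%:M -> dotp (x *m U) (y *m U) = dotp x y.
Proof. by move=> UU; rewrite dotp_mulmxl -mulmxA UU mulmx1. Qed.

Lemma householder_orthogonal (R : realType) n (w : 'rV[R]_n) :
  dotp w w != 0 ->
  let H := 1%:M - (2 / dotp w w) *: (w^T *m w) in H *m H^T = 1%:M.
Proof.
move=> w0 H; have -> : H^T = H.
  by rewrite linearB /= linearZ /= trmx_mul trmxK trmx1.
have WW : w^T *m w *m (w^T *m w) = dotp w w *: (w^T *m w).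
  by rewrite -mulmxA (mulmxA w) mulmx_dotp mul_scalar_mx scalemxAr.
rewrite mulmxBl mul1mx mulmxBr mulmx1 -scalemxAl -scalemxAr WW !scalerA.
rewrite -scalerBl -addrA -opprD -scalerDl.
set a := (X in X *: _).
by rewrite (_ : a = 0) ?scale0r ?subr0 // /a; field.
Qed.

(** The reflection that exchanges the first basis vector [e] and [c], in the
    hyperplane orthogonal to [e - c], has an orthogonal matrix with first
    row [c]. *)
Lemma unit_row_completion (R : realType) m (c : 'rV[R]_(1 + m)) :
  dotp c c = 1 ->
  exists B : 'M[R]_(m, 1 + m), col_mx c B *m (col_mx c B)^T = 1%:M.
Proof.
move=> cc; suff [U UU Uc] : exists2 U : 'M[R]_(1 + m),
    U *m U^T = 1%:M & usubmx U = c.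
  by exists (dsubmx U); rewrite -Uc vsubmxK.
pose e : 'rV[R]_(1 + m) := row_mx 1%:M 0.
have eU (U : 'M[R]_(1 + m)) : usubmx U = e *m U.
  by rewrite -{2}(vsubmxK U) mul_row_col mul1mx mul0mx addr0.
have ee : dotp e e = 1.
  by rewrite dotp_row_mx !dotpE mul0mx trmx1 mul1mx !mxE addr0.
pose w := e - c; have [w0|w0] := eqVneq (dotp w w) 0.
  exists 1%:M; first by rewrite trmx1 mulmx1.
  rewrite eU mulmx1; apply/eqP; rewrite -subr_eq0 -dotp_eq0; exact/eqP.
exists (1%:M - (2 / dotp w w) *: (w^T *m w)).
  exact: householder_orthogonal.
rewrite eU mulmxBr mulmx1 -scalemxAr mulmxA mulmx_dotp mul_scalar_mx scalerA.
have -> : 2 / dotp w w * dotp e w = 1.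
  apply: (mulIf w0); rewrite mulrAC divfK // mul1r /w.
  by rewrite !dotpDl !dotpDr !dotpNl !dotpNr ee cc (dotpC c e); ring.
by rewrite scale1r /w opprB addrC subrK.
Qed.

(** * Gram determinants and orthogonal projections *)

Definition gram (R : realType) m n (M : 'M[R]_(m, n)) : 'M[R]_m := M *m M^T.

Definition proj_rows (R : realType) m n (M : 'M[R]_(m, n)) : 'M[R]_n :=
  M^T *m invmx (gram M) *m M.

Lemma gram_unit (R : realType) m n (M : 'M[R]_(m, n)) :
  (gram M \in unitmx) = row_free M.
Proof.
apply/idP/idP => [gu|fM].
  by apply/row_freeP; exists (M^T *m invmx (gram M)); rewrite mulmxA mulmxV.
rewrite -row_free_unit -kermx_eq0; apply/rowV0P => v /sub_kermxP vg0.
apply/eqP; rewrite -(mulmx_free_eq0 v fM) -dotp_eq0 dotp_mulmxl dotpC.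
by rewrite -mulmxA vg0 dotpE mul0mx mxE.
Qed.

Lemma gram_sym (R : realType) m n (M : 'M[R]_(m, n)) : (gram M)^T = gram M.
Proof. by rewrite trmx_mul trmxK. Qed.

Lemma mulmx_proj_rows (R : realType) m n (M : 'M[R]_(m, n)) :
  row_free M -> M *m proj_rows M = M.
Proof. by move=> fM; rewrite !mulmxA mulmxV ?mul1mx ?gram_unit. Qed.

Lemma proj_rowsP (R : realType) m n (M : 'M[R]_(m, n)) :
  row_free M -> orthogonal_projection m (proj_rows M).
Proof.
move=> fM; split.
- by rewrite {1}/proj_rows -mulmxA mulmx_proj_rows.
- by rewrite !trmx_mul trmxK trmx_inv gram_sym mulmxA.
- apply/eqP; rewrite eqn_leq mulmx_max_rank /=.
  by rewrite -[X in (X <= _)%N](eqP fM) -{1}(mulmx_proj_rows fM) mxrankM_maxr.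
Qed.

Lemma orthogonal_projection_compl (R : realType) n j (P : 'M[R]_n) :
  orthogonal_projection j P -> orthogonal_projection (n - j) (1%:M - P).
Proof.
case=> PP PT rP; split.
- by rewrite mulmxBl mul1mx mulmxBr mulmx1 PP subrr subr0.
- by rewrite linearB /= trmx1 PT.
apply/eqP; rewrite -rP -mxrank_ker eqn_leq; apply/andP; split; apply: mxrankS.
  by apply/sub_kermxP; rewrite mulmxBl mul1mx PP subrr.
have {1}-> : kermx P = kermx P *m (1%:M - P).
  by rewrite mulmxBr mulmx1 mulmx_ker subr0.
exact: submxMl.
Qed.

Lemma dotp_proj_residue (R : realType) n j (P : 'M[R]_n) (x : 'rV[R]_n) :
  orthogonal_projection j P -> dotp (x - x *m P) (x - x *m P) <= dotp x x.
Proof.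
case=> PP PT _.
have PE y : dotp (x *m P) y = dotp x (y *m P) by rewrite dotp_mulmxl PT.
have := dotp_ge0 (x *m P).
rewrite !dotpDl !dotpDr !dotpNl !dotpNr !PE -mulmxA PP; lra.
Qed.

(** Pythagoras: [w *m N] is fixed by the projection, so [x] and [x - w *m N]
    have the same residue. *)
Lemma dotp_proj_nearest (R : realType) m n (N : 'M[R]_(m, n)) x w :
  row_free N ->
  dotp (x - x *m proj_rows N) (x - x *m proj_rows N)
    <= dotp (x - w *m N) (x - w *m N).
Proof.
move=> fN; apply: le_trans (dotp_proj_residue (x - w *m N)
  (proj_rowsP fN)).
by rewrite mulmxBl -mulmxA mulmx_proj_rows // opprB addrA subrK.
Qed.

(** Base times height, for squared volumes: subtracting from the row [u] its
    projection on the row space of [N] is a unimodular operation that makes the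
    Gram matrix block diagonal. *)
Lemma det_gram_col_mx (R : realType) m n (u : 'rV[R]_n) (N : 'M[R]_(m, n)) :
  row_free N ->
  \det (gram (col_mx u N))
    = dotp (u - u *m proj_rows N) (u - u *m proj_rows N) * \det (gram N).
Proof.
move=> fN; set d := u - _.
pose T : 'M[R]_(1 + m) :=
  block_mx 1%:M (- (u *m N^T *m invmx (gram N))) 0 1%:M.
have detT : \det T = 1 by rewrite det_ublock !det1 mulr1.
have TE : T *m col_mx u N = col_mx d N.
  by rewrite mul_block_col !mul1mx mul0mx add0r mulNmx /d !mulmxA.
have dN : d *m N^T = 0.
  have [_ PT _] := proj_rowsP fN.
  rewrite mulmxBl -[X in _ - X]mulmxA -PT -trmx_mul mulmx_proj_rows //.
  exact: subrr.
have -> : \det (gram (col_mx u N)) = \det (gram (col_mx d N)).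
  by rewrite -TE /gram trmx_mul mulmxA -(mulmxA T) !det_mulmx det_tr detT
    mulr1 mul1r.
have Nd : N *m d^T = 0 by rewrite -(trmxK N) -trmx_mul dN trmx0.
rewrite /gram tr_col_mx mul_col_row dN Nd mulmx_dotp det_ublock.
by rewrite det_mx11 mxE.
Qed.

Lemma det_gram_mulmx (R : realType) m n (T : 'M[R]_m) (M : 'M[R]_(m, n)) :
  \det (gram (T *m M)) = \det T ^+ 2 * \det (gram M).
Proof.
by rewrite /gram trmx_mul mulmxA -(mulmxA T) !det_mulmx det_tr; ring.
Qed.

Lemma det_gram_neq0 (R : realType) m n (M : 'M[R]_(m, n)) :
  \det (gram M) != 0 -> row_free M.
Proof. by rewrite -gram_unit unitmxE unitfE. Qed.

Lemma row_free_dsub (R : realType) l m n (L : 'M[R]_(l, n)) (M : 'M[R]_(m, n)) :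
  row_free (col_mx L M) -> row_free M.
Proof.
rewrite -!kermx_eq0 => /rowV0P kL; apply/rowV0P => v /sub_kermxP vM.
have /eqP : row_mx (0 : 'rV[R]_l) v = 0.
  by apply/kL/sub_kermxP; rewrite mul_row_col mul0mx vM addr0.
by rewrite row_mx_eq0 => /andP[_ /eqP].
Qed.

Lemma det_gram_col_mxZ (R : realType) m n (x : 'rV[R]_n) (N : 'M[R]_(m, n))
    (a b : R) :
  row_free N ->
  \det (gram (col_mx (a *: x) (b *: N)))
    = a ^+ 2 * (b ^+ 2) ^+ m
      * enorm (x - x *m proj_rows N) ^+ 2 * \det (gram N).
Proof.
move=> fN; pose T : 'M[R]_(1 + m) := block_mx a%:M 0 0 b%:M.
have -> : col_mx (a *: x) (b *: N) = T *m col_mx x N.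
  by rewrite mul_block_col !mul0mx addr0 add0r !mul_scalar_mx.
rewrite det_gram_mulmx det_gram_col_mx // det_ublock !det_scalar enorm_sqr.
by rewrite expr1 exprMn exprAC mulrA.
Qed.

(** * Kolmogorov widths *)

(** A set without a supremum has the default value [0]. *)
Lemma sup_image_ge0 (R : realType) (T : Type) (S : set T) (f : T -> R) :
  (forall x, 0 <= f x) -> 0 <= sup [set f x | x in S].
Proof.
move=> f0; have [hS|nS] := pselect (has_sup [set f x | x in S]).
  have [[_ [x Sx _]] _] := hS; apply: le_trans (f0 x) _.
  by apply: sup_upper_bound => //; exists x.
by rewrite sup_out.
Qed.

Lemma kolmogorov_width_le_sup (R : realType) n (K : set 'rV[R]_n) j P :
  orthogonal_projection j P ->
  kolmogorov_width K j <= sup [set enorm (x - x *m P) | x in K].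
Proof.
move=> hP; apply: ge_inf; last by exists P.
by exists 0 => _ [Q _ <-]; apply: sup_image_ge0 => x; exact: enorm_ge0.
Qed.

Lemma kolmogorov_width_le (R : realType) n (K : set 'rV[R]_n) j P r :
  K !=set0 -> orthogonal_projection j P ->
  (forall x, K x -> enorm (x - x *m P) <= r) -> kolmogorov_width K j <= r.
Proof.
move=> [x0 Kx0] hP hr; apply: le_trans (kolmogorov_width_le_sup K hP) _.
apply: ge_sup => [|_ [x Kx <-]]; last exact: hr.
by exists (enorm (x0 - x0 *m P)), x0.
Qed.

(** The rank factorization of [P] extends the rows spanning its range to a basis
    of the whole space, of which the first [k] are taken. *)
Lemma row_free_superspace (R : realType) p n (P : 'M[R]_(p, n)) k :
  (\rank P <= k <= n)%N ->
  exists2 N : 'M[R]_(k, n), row_free N & (P <= N)%MS.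
Proof.
move=> /andP[rk kn]; exists ((pid_mx k : 'M[R]_(k, n)) *m row_ebase P).
  by rewrite /row_free mxrankMfree ?row_free_unit ?row_ebase_unit //
    rank_pid_mx.
apply/submxP; exists (col_ebase P *m (pid_mx (\rank P) : 'M[R]_(p, k))).
by rewrite mulmxA -(mulmxA (col_ebase P)) mul_pid_mx
  (minn_idPl rk) (minn_idPr rk) mulmx_ebase.
Qed.

(** A projection of smaller rank only does worse, since its range lies in a
    subspace of dimension [k], which is no farther from [x]. *)
Lemma exists_far_point (R : realType) n (X : set 'rV[R]_n) j k P b :
  X !=set0 -> orthogonal_projection j P -> (j <= k <= n)%N ->
  b < kolmogorov_width X k ->
  exists2 x, X x & b < enorm (x - x *m P).
Proof.
move=> [x0 Xx0] [PP PT <-] jkn bX.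
have [N fN /submxP[D PE]] := row_free_superspace jkn.
have /(lt_le_trans bX)/sup_gt := kolmogorov_width_le_sup X (proj_rowsP fN).
have ne : [set enorm (x - x *m proj_rows N) | x in X] !=set0.
  by exists (enorm (x0 - x0 *m proj_rows N)), x0.
move=> /(_ ne)[_ [x Xx <-] bx]; exists x => //; apply: lt_le_trans bx _.
by rewrite ler_wsqrtr // [in leRHS]PE (mulmxA x D); exact: dotp_proj_nearest.
Qed.

(** * Ellipsoids inscribed in a symmetric convex set *)

Lemma symmetric_convex_comb (R : realType) n (X : set 'rV[R]_n) (a b : R) x y :
  convex_set X -> centrally_symmetric X ->
  `|a| + `|b| <= 1 -> X x -> X y -> X (a *: x + b *: y).
Proof.
move=> cX sX; have mix (s : R) u v : 0 <= s <= 1 -> X u -> X v ->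
    X (s *: u + (1 - s) *: v).
  move=> /andP[s0 s1] Xu Xv.
  by have := cX _ _ (Itv01 s0 s1) (mem_set Xu) (mem_set Xv) => /set_mem.
move=> ab Xx Xy; have X0 : X 0.
  have h : 0 <= (2^-1 : R) <= 1 by lra.
  have := mix 2^-1 x (- x) h Xx (sX _ Xx).
  by rewrite scalerN -scalerBl (_ : _ - _ = 0 :> R) ?scale0r //; lra.
have sgn c z : X z -> exists2 z', X z' & c *: z = `|c| *: z'.
  move=> Xz; have [c0|c0] := leP 0 c; first by exists z; rewrite ?ger0_norm.
  by exists (- z); [exact: sX|rewrite ltr0_norm // scalerN scaleNr opprK].
have [x' Xx' ->] := sgn a _ Xx; have [y' Xy' ->] := sgn b _ Xy.
have a0 := normr_ge0 a; have b0 := normr_ge0 b; set t := `|a| + `|b| in ab.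
have [t0|t0] := eqVneq t 0.
  have -> : `|a| = 0 by move: t0; rewrite /t; lra.
  have -> : `|b| = 0 by move: t0; rewrite /t; lra.
  by rewrite !scale0r addr0.
have tp : 0 < t by rewrite lt_neqAle eq_sym t0 addr_ge0.
have -> : `|a| *: x' + `|b| *: y'
    = t *: (`|a| / t *: x' + (1 - `|a| / t) *: y') + (1 - t) *: 0.
  rewrite scaler0 addr0 scalerDr !scalerA mulrBr mulr1 mulrC divfK //.
  by rewrite /t [in X in _ = _ + X]addrAC subrr add0r.
apply: (mix) => //; first by rewrite ltW.
apply: (mix) => //; rewrite divr_ge0 ?(ltW tp) //= ler_pdivrMr // mul1r /t; lra.
Qed.

(** The set of the [z *m M] with [dotp z z <= 1] is an ellipsoid, possibly
    degenerate; [\det (gram M)] is the square of the ratio of its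
    [m]-dimensional volume to that of the unit ball. *)
Definition inscribed (R : realType) m n (X : set 'rV[R]_n)
    (M : 'M[R]_(m, n)) : Prop :=
  forall z, dotp z z <= 1 -> X (z *m M).

Lemma inscribed_isometry (R : realType) l m n (X : set 'rV[R]_n)
    (U : 'M[R]_(l, m)) (M : 'M[R]_(m, n)) :
  U *m U^T = 1%:M -> inscribed X M -> inscribed X (U *m M).
Proof.
by move=> UU XM z zz; rewrite mulmxA; apply: XM; rewrite dotp_isometry.
Qed.

Lemma inscribed_dsub (R : realType) l m n (X : set 'rV[R]_n)
    (L : 'M[R]_(l, n)) (M : 'M[R]_(m, n)) :
  inscribed X (col_mx L M) -> inscribed X M.
Proof.
move=> XM z zz; have := XM (row_mx 0 z).
rewrite mul_row_col mul0mx add0r; apply.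
by rewrite dotp_row_mx dotpE mul0mx mxE add0r.
Qed.

(** A point of the new ellipsoid is a combination of [x] and of a point of the
    old one with coefficients [a * s] and [b * t], where [(s, t)] lies in the
    unit disc; by Cauchy-Schwarz their absolute values add up to at most [1]. *)
Lemma inscribed_col_mx (R : realType) m n (X : set 'rV[R]_n)
    (M : 'M[R]_(m, n)) x (a b : R) :
  convex_set X -> centrally_symmetric X -> X x -> inscribed X M ->
  a ^+ 2 + b ^+ 2 <= 1 -> inscribed X (col_mx (a *: x) (b *: M)).
Proof.
move=> cX sX Xx XM ab z; rewrite -(hsubmxK z).
move: (lsubmx z) (rsubmx z) => s t; rewrite dotp_row_mx mul_row_col => st.
have [u uu tE] := enorm_normalize t; set e := enorm t in tE.
have te : dotp t t = e ^+ 2 by rewrite enorm_sqr.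
have -> : s *m (a *: x) = (s 0 0 * a) *: x.
  by rewrite [in LHS](mx11_scalar s) mul_scalar_mx scalerA.
have -> : t *m (b *: M) = (e * b) *: (u *m M).
  by rewrite tE -scalemxAl -scalemxAr scalerA.
have ss : dotp s s = s 0 0 ^+ 2 by rewrite /dotp big_ord1 -expr2.
apply: symmetric_convex_comb => //; last exact: XM.
rewrite !normrM; move: st; rewrite te ss -(real_normK (num_real (s 0 0))).
move: ab; rewrite -(real_normK (num_real a)) -(real_normK (num_real b)).
rewrite -(real_normK (num_real e)).
move: `|_| `|_| `|_| `|_| => p q p' q'.
have := sqr_ge0 (p - p'); have := sqr_ge0 (q - q'); rewrite !sqrrB; lra.
Qed.

Lemma det_bound (R : realType) m (A : 'M[R]_m) C :
  (forall i j, `|A i j| <= C) -> `|\det A| <= (m`!)%:R * C ^+ m.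
Proof.
move=> AC; apply: le_trans (ler_norm_sum _ _ _) _.
have -> : (m`!)%:R * C ^+ m = \sum_(s : 'S_m) C ^+ m.
  by rewrite sumr_const card_Sn mulr_natl.
apply: ler_sum => s _; rewrite normrM normrX normrN1 expr1n mul1r normr_prod.
rewrite -[X in C ^+ X]card_ord -prodr_const; apply: ler_prod => i _.
by rewrite normr_ge0 AC.
Qed.

(** Makes the supremum of the volumes of inscribed ellipsoids finite. *)
Lemma inscribed_bounded (R : realType) m n (X : set 'rV[R]_n) :
  compact X ->
  exists B, forall M : 'M[R]_(m, n), inscribed X M -> \det (gram M) <= B.
Proof.
move=> /compact_bounded[C [_ /(_ (C + 1))]]; rewrite ltrDl ltr01 => /(_ isT).
move: (C + 1) => {}C XC; exists ((m`!)%:R * (C ^+ 2 *+ n) ^+ m) => M XM.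
have MC i j : `|M i j| <= C.
  have Xi : X (row i M).
    rewrite rowE; apply: XM; rewrite dotpE trmx_delta mul_delta_mx.
    by rewrite mxE !eqxx.
  apply: le_trans (XC _ Xi); rewrite [leRHS]/Num.norm /= mx_normrE.
  by apply/bigmax_geP; right => /=; exists (0, j) => //=; rewrite mxE.
apply: le_trans (ler_norm _) _; apply: det_bound => i j; rewrite mxE.
apply: le_trans (ler_norm_sum _ _ _) _.
rewrite -[X in _ *+ X]card_ord -sumr_const; apply: ler_sum => l _.
by rewrite mxE normrM expr2 ler_pM.
Qed.

Lemma bernoulli_ineq (R : realType) (t : R) m :
  0 <= t <= 1 -> 1 - m%:R * t <= (1 - t) ^+ m.
Proof.
move=> /andP[t0 t1]; elim: m => [|m IH]; first by rewrite mul0r subr0 expr0.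
have : (1 - m%:R * t) * (1 - t) <= (1 - t) ^+ m.+1.
  by rewrite exprSr ler_wpM2r // subr_ge0.
apply: le_trans; rewrite -natr1.
have : 0 <= m%:R * t * t by rewrite !mulr_ge0.
lra.
Qed.

(** While fewer than [k] axes have been chosen, their span misses some point of
    [X], which provides one more. *)
Lemma exists_inscribed_nondegenerate (R : realType) n (X : set 'rV[R]_n) k m :
  X !=set0 -> convex_set X -> centrally_symmetric X ->
  (m <= k <= n)%N -> 0 < kolmogorov_width X k ->
  exists2 M : 'M[R]_(m, n), inscribed X M & 0 < \det (gram M).
Proof.
move=> X0 cX sX /andP[mk kn] dX; elim: m mk => [_|m IH mk].
  exists 0; last by rewrite det_mx00.
  move=> z _; rewrite mulmx0; have [x Xx] := X0.
  have := @symmetric_convex_comb _ _ X 0 0 x x cX sX.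
  by rewrite normr0 !scale0r !addr0; apply.
have [N XN N0] := IH (ltnW mk); have fN := det_gram_neq0 (lt0r_neq0 N0).
have mkn : (m <= k <= n)%N by rewrite ltnW.
have [x Xx x0] := exists_far_point X0 (proj_rowsP fN) mkn dX.
exists (col_mx (2^-1 *: x) (2^-1 *: N) : 'M[R]_(1 + m, n)).
  by apply: inscribed_col_mx => //; lra.
by rewrite det_gram_col_mxZ // !mulr_gt0 // !exprn_gt0.
Qed.

(** An ellipsoid whose squared volume exceeds half of the supremum has only long
    semi-axes: a short one could be traded for a point of [X] at distance [b]
    from the span of the others, at a gain of volume that exceeds the slack. *)
Lemma exists_fat_inscribed (R : realType) n (X : set 'rV[R]_n) k m b :
  X !=set0 -> compact X -> convex_set X -> centrally_symmetric X ->
  (m <= k <= n)%N -> 0 < b < kolmogorov_width X k ->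
  exists M : 'M[R]_(m, n), [/\ inscribed X M, row_free M &
    forall z, b ^+ 2 * dotp z z <= 8 * m%:R * dotp (z *m M) (z *m M)].
Proof.
move=> X0 kX cX sX mkn /andP[b0 bX]; have dX := lt_trans b0 bX.
have [M0 XM0 G0] := exists_inscribed_nondegenerate X0 cX sX mkn dX.
case: m mkn M0 XM0 G0 => [|m] mkn M0 XM0 G0.
  exists M0; split=> [//||z]; first exact/det_gram_neq0/lt0r_neq0.
  by rewrite [z]thinmx0 mul0mx !dotpE !mul0mx !mxE !mulr0.
have [B XB] := inscribed_bounded m.+1 kX.
pose S := [set \det (gram M) | M in @inscribed R m.+1 n X].
have ubS : has_ubound S by exists B => _ [M XM <-]; exact: XB.
have GS (M : 'M[R]_(m.+1, n)) : inscribed X M -> \det (gram M) <= sup S.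
  by move=> XM; apply: ub_le_sup => //; exists M.
have S0 := lt_le_trans G0 (GS _ XM0).
have [||_ [M XM <-] GM] := @sup_gt _ S (sup S / 2).
- by exists (\det (gram M0)), M0.
- by lra.
have GM0 : 0 < \det (gram M) by lra.
exists M; split=> [//||z]; first exact/det_gram_neq0/lt0r_neq0.
have [z0|z0] := eqVneq z 0.
  by rewrite z0 mul0mx !dotpE !mul0mx mxE !mulr0.
have ez0 : 0 < dotp z z by rewrite lt_neqAle eq_sym dotp_eq0 z0 dotp_ge0.
pose e := enorm z; have e2 : e ^+ 2 = dotp z z := enorm_sqr z.
have e0 : e != 0 by rewrite -sqrf_eq0 e2 dotp_eq0.
have [c cc zE] : exists2 c : 'rV[R]_(1 + m), dotp c c = 1 & z = e *: c.
  exists (e^-1 *: z); last by rewrite scalerA divff // scale1r.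
  by rewrite dotpZl dotpZr mulrA -expr2 exprVn e2 mulVf // lt0r_neq0.
suff cM : b ^+ 2 <= 8 * m.+1%:R * dotp (c *m M) (c *m M).
  rewrite zE -scalemxAl !dotpZl !dotpZr cc.
  by have := ler_wpM2l (sqr_ge0 e) cM; lra.
(* In the parametrization [U *m M], the point [c *m M] is the first row and the
   rows of [N] span the rest of the ellipsoid. *)
have [C UU] := unit_row_completion cc; pose U := col_mx c C.
pose u := c *m M; pose N := C *m M; rewrite -/u.
have UME : U *m M = col_mx u N by rewrite mul_col_mx.
have XuN : inscribed X (col_mx u N) by rewrite -UME; exact: inscribed_isometry.
have GuN : \det (gram (col_mx u N)) = \det (gram M).
  by rewrite -UME det_gram_mulmx expr2 -{2}det_tr -det_mulmx UU det1 mul1r.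
have fN : row_free N.
  apply: (@row_free_dsub _ 1 _ _ u); apply: det_gram_neq0.
  by rewrite GuN lt0r_neq0.
have GE := det_gram_col_mx u fN; rewrite GuN in GE.
have dN := dotp_proj_residue u (proj_rowsP fN).
have dN0 := dotp_ge0 (u - u *m proj_rows N).
have GN : 0 < \det (gram N).
  rewrite ltNge; apply/negP => GN; have := mulr_ge0_le0 dN0 GN.
  by rewrite -GE; lra.
have mkn' : (m <= k <= n)%N by case/andP: mkn => /ltnW ->.
have [x Xx bx] := exists_far_point X0 (proj_rowsP fN) mkn' bX.
(* Up to a constant factor, this [l] maximises [l * (1 - l) ^+ m], the effect
   of the shrinking on the squared volume. *)
pose l : R := (2 * m.+1%:R)^-1.
have m0 : 1 <= m.+1%:R :> R by rewrite ler1n.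
have l1 : l * (2 * m.+1%:R) = 1 by rewrite mulVf // mulf_neq0 // pnatr_eq0.
have l0 : 0 < l by rewrite invr_gt0; lra.
have l01 : 0 <= l <= 1 by rewrite (ltW l0) /= invf_le1; lra.
have /andP[_ l_le1] := l01.
have XN' : inscribed X (col_mx (Num.sqrt l *: x) (Num.sqrt (1 - l) *: N)).
  apply: inscribed_col_mx => //; first exact: inscribed_dsub XuN.
  by rewrite !sqr_sqrtr ?subr_ge0 ?(ltW l0) // addrC subrK.
have l1_ge0 : 0 <= 1 - l by rewrite subr_ge0.
have := GS _ XN'.
rewrite det_gram_col_mxZ // (sqr_sqrtr (ltW l0)) (sqr_sqrtr l1_ge0).
set D := enorm _ ^+ 2 => GD.
have bD : b ^+ 2 <= D by rewrite ler_pXn2r ?nnegrE ?enorm_ge0 // ltW.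
have lE : l / 2 <= l * (1 - l) ^+ m.
  rewrite ler_wpM2l ?(ltW l0) //; apply: le_trans (bernoulli_ineq m l01).
  by move: l1 l0; rewrite -[m.+1%:R]natr1; lra.
have : l / 2 * b ^+ 2 * \det (gram N) < 2 * dotp u u * \det (gram N).
  apply: (@le_lt_trans _ _ (sup S)).
    apply: le_trans GD; rewrite ler_wpM2r ?(ltW GN) //.
    by apply: ler_pM => //; [rewrite divr_ge0 // ltW|exact: sqr_ge0].
  have := ler_wpM2r (ltW GN) dN; rewrite -GE; lra.
rewrite ltr_pM2r // => /ltW h.
have := ler_wpM2l (_ : 0 <= 4 * m.+1%:R) h; rewrite mulr_ge0 // => /(_ isT).
have -> : 4 * m.+1%:R * (l / 2 * b ^+ 2) = l * (2 * m.+1%:R) * b ^+ 2 by field.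
by rewrite l1 mul1r; lra.
Qed.

(** * Width of the polar *)

Lemma polar0 (R : realType) n (X : set 'rV[R]_n) : polar X 0.
Proof.
split=> [_ [[V ->] _]|x _] /=; first exact: mem0v.
by rewrite dotpC dotpE mul0mx mxE.
Qed.

Lemma dotp_polar_le (R : realType) m n (X : set 'rV[R]_n)
    (M : 'M[R]_(m, n)) z y :
  inscribed X M -> polar X y -> dotp (z *m M) y <= enorm z.
Proof.
move=> XM [_ Xy]; have [u uu zE] := enorm_normalize z.
rewrite {1}zE -scalemxAl dotpZl -[leRHS]mulr1 ler_wpM2l ?enorm_ge0 //.
exact/Xy/XM.
Qed.

(** If [z *m M] is the projection of [y], then its squared length is
    [dotp (z *m M) y], hence at most [enorm z]; the hypothesis on [M] bounds
    [enorm z] by a multiple of the length itself. *)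
Lemma kolmogorov_width_polar_le (R : realType) m n (X : set 'rV[R]_n)
    (M : 'M[R]_(m, n)) b C :
  0 < b -> inscribed X M -> row_free M ->
  (forall z, b ^+ 2 * dotp z z <= C * dotp (z *m M) (z *m M)) ->
  kolmogorov_width (polar X) (n - m) <= Num.sqrt C / b.
Proof.
move=> b0 XM fM bM; have [QQ QT rQ] := proj_rowsP fM.
apply: (kolmogorov_width_le _ (orthogonal_projection_compl (proj_rowsP fM))).
  by exists 0; exact: polar0.
move=> y Xy; rewrite mulmxBr mulmx1 opprB addrC subrK.
rewrite ler_pdivlMr //; set q := enorm _.
have [q0|q0] := eqVneq q 0; first by rewrite q0 mul0r sqrtr_ge0.
pose z := y *m M^T *m invmx (gram M).
have zM : y *m proj_rows M = z *m M by rewrite !mulmxA.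
have q2 : q ^+ 2 = dotp (z *m M) (z *m M) by rewrite -zM enorm_sqr.
have qz : q ^+ 2 <= enorm z.
  apply: le_trans (dotp_polar_le z XM Xy).
  by rewrite q2 -zM dotp_mulmxl QT -mulmxA QQ dotpC.
rewrite -(ger0_norm (mulr_ge0 (enorm_ge0 _) (ltW b0))) -sqrtr_sqr.
have q2p : 0 < q ^+ 2 by rewrite exprn_even_gt0.
apply: ler_wsqrtr; rewrite exprMn -(ler_pM2r q2p).
apply: le_trans (_ : b ^+ 2 * dotp z z <= _); last by rewrite q2; exact: bM.
rewrite mulrAC mulrC ler_wpM2l ?sqr_ge0 // -expr2 -enorm_sqr.
by rewrite ler_pXn2r ?nnegrE ?enorm_ge0 ?sqr_ge0.
Qed.

Lemma kolmogorov_width_mul_polar_le (R : realType) n (X : set 'rV[R]_n) k m :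
  X !=set0 -> compact X -> convex_set X -> centrally_symmetric X ->
  (m <= k <= n)%N ->
  kolmogorov_width X k * kolmogorov_width (polar X) (n - m)
    <= 4 * Num.sqrt m%:R.
Proof.
move=> X0 kX cX sX mkn; set a := kolmogorov_width X k.
set d := kolmogorov_width _ _.
have s0 : 0 <= 4 * Num.sqrt (m%:R : R) by rewrite mulr_ge0 ?sqrtr_ge0.
have d0 : 0 <= d.
  rewrite /d /kolmogorov_width; set S := [set _ | _ in _].
  have [S0|/set0P/negP/negPn/eqP ->] := pselect (S !=set0); last by rewrite inf0.
  apply: lb_le_inf => // _ [P _ <-].
  by apply: sup_image_ge0 => x; exact: enorm_ge0.
have [a0|a0] := leP a 0; first exact: le_trans (mulr_le0_ge0 a0 d0) s0.
(* The fraction [1 / sqrt 2] of the width, strictly below it as far points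
   require, turns [sqrt (8 * m)] into [4 * sqrt m]. *)
have r2 : Num.sqrt (2 : R) ^+ 2 = 2 by rewrite sqr_sqrtr.
have r1 : 1 < Num.sqrt (2 : R) by have := sqrtr_ge0 (2 : R); nra.
have rp : 0 < Num.sqrt (2 : R) by lra.
pose b := a / Num.sqrt 2.
have ba : 0 < b < a by rewrite divr_gt0 //= ltr_pdivrMr // ltr_pMr.
have [M [XM fM bM]] := exists_fat_inscribed X0 kX cX sX mkn ba.
have /andP[b0 _] := ba.
have := kolmogorov_width_polar_le b0 XM fM bM; rewrite -/d => dle.
apply: le_trans (ler_wpM2l (ltW a0) dle) _.
have -> : 8 * m%:R = (2 * Num.sqrt 2) ^+ 2 * m%:R :> R.
  by rewrite exprMn r2; ring.
rewrite sqrtrM ?sqr_ge0 // sqrtr_sqr ger0_norm; last by lra.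
rewrite /b le_eqVlt; apply/orP; left; apply/eqP.
have -> : 4 = 2 * (Num.sqrt (2 : R) ^+ 2) :> R by rewrite r2; ring.
by field; rewrite !lt0r_neq0.
Qed.

Lemma c1_bounds (R : realType) : 4 <= c1 R <= 5.
Proof.
have r2 : Num.sqrt (2 : R) ^+ 2 = 2 by rewrite sqr_sqrtr.
have r0 : 0 <= Num.sqrt (2 : R) := sqrtr_ge0 _.
have r14 : 7 / 5 <= Num.sqrt (2 : R) by nra.
have r15 : Num.sqrt (2 : R) <= 3 / 2 by nra.
by rewrite /c1 ler_pdivlMr ?ler_pdivrMr; lra.
Qed.

(** * The product of the widths *)

Theorem theorem3p3 (R : realType) (n : nat) (X : set 'rV[R]_n)
  (X_nonempty : X !=set0) (X_compact : compact X) (X_convex : convex_set X)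
  (X_symmetric : centrally_symmetric X)
  (k : nat) (k_le_n : (k <= n)%N)
  (eps : R) (eps_gt0 : 0 < eps) (eps_lt1 : eps < 1) :
  kolmogorov_width X k
    * kolmogorov_width_real (polar X) (n%:R - (1 - eps) * k%:R)
    <= c1 R * Num.sqrt (k%:R / eps)
  /\ c1 R <= 5.
Proof.
have /andP[c4 c5] := c1_bounds R; split=> //.
rewrite /kolmogorov_width_real; set t := _ - _; set j := Num.truncn t.
have kn : k%:R <= n%:R :> R by rewrite ler_nat.
have k0 : 0 <= k%:R :> R by [].
have t_ge : (n - k)%:R <= t by rewrite natrB // /t; nra.
have t_le : t <= n%:R by rewrite /t; nra.
have t0 : 0 <= t := le_trans (ler0n _ _) t_ge.
have nkj : (n - k <= j)%N by rewrite truncn_ge_nat.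
have jn : (j <= n)%N.
  by rewrite -(ler_nat R); apply: le_trans t_le; rewrite truncn_le.
have mkn : (n - j <= k <= n)%N by rewrite k_le_n andbT leq_subCl.
have := kolmogorov_width_mul_polar_le X_nonempty X_compact X_convex
  X_symmetric mkn.
rewrite subKn // => /le_trans; apply.
apply: ler_pM => //.
apply: ler_wsqrtr; rewrite ler_pdivlMr //.
have : (n - j)%:R <= k%:R :> R by rewrite ler_nat; case/andP: mkn.
have : 0 <= (n - j)%:R :> R by [].
nra.
Qed.
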